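(* Let $Q(t)=t^4+a_3t^3+a_2t^2+a_1t+a_0$ be a monic complex quartic polynomial. For every locally constant cycle $\gamma$ on the cyclic triple cover $y^3=\frac{z-t}{Q(z)}$, the period $$I_\gamma(t)=\int_\gamma (z-t)^{-2/3}Q(z)^{-1/3}\,dz$$ satisfies $$81Q(t)I_\gamma'''(t)+162Q'(t)I_\gamma''(t)+90Q''(t)I_\gamma'(t)+10Q'''(t)I_\gamma(t)=0 .$$
   Context: A locally constant cycle $\gamma$ is a closed cycle on the triple cover of the $z$-plane, avoiding the points over $z=t$ and over the zeros of $Q$, which is kept fixed (as a path in the $z$-plane together with a continuous single-valued choice of branch of $(z-t)^{-2/3}Q(z)^{-1/3}$ along it) as $t$ varies in a small open set of values with $Q(t)\neq0$. *)

(* Defs.v *)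
From Stdlib Require Import Reals ZArith List.
From Coquelicot Require Import Coquelicot.

Open Scope C_scope.

Definition quartic (a3 a2 a1 a0 : C) (t : C) : C :=
  t ^ 4 + a3 * t ^ 3 + a2 * t ^ 2 + a1 * t + a0.

(* [C_derive f t] is the complex derivative only where [f] is complex
   differentiable, so its use has to be accompanied by [C_ex_derive_n]. *)
Definition C_derive_n (n : nat) (f : C -> C) : C -> C := Nat.iter n C_derive f.

Definition C_ex_derive_n (n : nat) (f : C -> C) (t : C) : Prop :=
  forall k : nat, (k < n)%nat ->
    ex_derive (K := C_AbsRing) (V := C_NormedModule) (C_derive_n k f) t.

(* On each closed piece the path is the restriction of a C^1 map R -> C, which
   amounts to being C^1 there with one-sided derivatives at the end points. *)
Definition piecewise_C1 (g : R -> C) : Prop :=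
  exists (n : nat) (s : nat -> R),
    s 0%nat = 0%R /\ s n = 1%R /\
    forall i : nat, (i < n)%nat ->
      (s i < s (S i))%R /\
      exists h dh : R -> C,
        (forall x : R,
           is_derive (K := R_AbsRing) (V := C_R_NormedModule) h x (dh x) /\
           continuous (U := C_UniformSpace) dh x) /\
        (forall x : R, (s i <= x <= s (S i))%R -> g x = h x).

(* At the finitely many corners of a piecewise C^1 path this value is
   meaningless, which does not affect integrals. *)
Definition path_derive (g : R -> C) (s : R) : C :=
  (Derive (fun x => fst (g x)) s, Derive (fun x => snd (g x)) s).

(* The integral along [g : [0,1] -> C] of [f dz], where [f] is given as a
   function of the parameter because it may be multivalued as a function of z. *)
Definition path_integral (g : R -> C) (f : R -> C) : C :=
  RInt (V := C_R_CompleteNormedModule)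
    (fun s : R => f s * path_derive g s) 0 1.

Definition triple_cover (Q : C -> C) (t z y : C) : Prop :=
  y ^ 3 = (z - t) / Q z.

(* [w] is one of the three values of (z - t)^(-2/3) Q(z)^(-1/3). *)
Definition is_branch_value (Q : C -> C) (t z w : C) : Prop :=
  w ^ 3 = / ((z - t) ^ 2 * Q z).

(* Choosing such a value over z is the same as choosing the point
   y = (z - t) w of the triple cover over z. *)
Lemma is_branch_value_cover (Q : C -> C) (t z w : C) :
  z <> t -> Q z <> 0 ->
  (is_branch_value Q t z w <-> triple_cover Q t z ((z - t) * w)).
Proof.
intros Hz HQ; unfold is_branch_value, triple_cover.
assert (H : z - t <> 0).
{ intro E; apply Hz.
  replace z with ((z - t) + t) by ring; rewrite E; ring. }
rewrite Cpow_mult_l; split; intro E.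
- rewrite E; field; auto.
- replace (w ^ 3) with (/ (z - t) ^ 3 * ((z - t) ^ 3 * w ^ 3)).
  + rewrite E; field; auto.
  + field; auto.
Qed.

(* A closed path on the triple cover whose projection [loop_path] to the
   z-plane does not depend on t in U; [loop_branch t s] is the branch of
   (z - t)^(-2/3) Q(z)^(-1/3) at z = loop_path s.  Only the parameters
   t in U and s in [0,1] are meaningful. *)
Record const_loop (Q : C -> C) (U : C -> Prop) : Type := ConstLoop {
  loop_path : R -> C;
  loop_branch : C -> R -> C;
  loop_path_C1 : piecewise_C1 loop_path;
  loop_path_closed : loop_path 0%R = loop_path 1%R;
  loop_avoids_t : forall (t : C) (s : R),
    U t -> (0 <= s <= 1)%R -> loop_path s <> t;
  loop_avoids_zeros : forall s : R,
    (0 <= s <= 1)%R -> Q (loop_path s) <> 0;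
  loop_branchP : forall (t : C) (s : R),
    U t -> (0 <= s <= 1)%R ->
    is_branch_value Q t (loop_path s) (loop_branch t s);
  loop_branch_continuous : forall (t : C) (s : R),
    U t -> (0 <= s <= 1)%R ->
    filterlim (fun p : C * R => loop_branch (fst p) (snd p))
      (within (fun p : C * R => U (fst p) /\ (0 <= snd p <= 1)%R)
        (locally (T := prod_UniformSpace C_UniformSpace R_UniformSpace) (t, s)))
      (locally (T := C_UniformSpace) (loop_branch t s));
  loop_branch_closed : forall t : C,
    U t -> loop_branch t 0%R = loop_branch t 1%R
}.

Arguments loop_path {Q U} _ _.
Arguments loop_branch {Q U} _ _ _.

(* Finite integral combinations of closed paths; a single closed path [l] is
   [(1%Z, l) :: nil]. *)
Definition locally_constant_cycle (Q : C -> C) (U : C -> Prop) : Type :=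
  list (Z * const_loop Q U).

Definition loop_period {Q : C -> C} {U : C -> Prop} (l : const_loop Q U)
    (t : C) : C :=
  path_integral (loop_path l) (loop_branch l t).

Definition period {Q : C -> C} {U : C -> Prop}
    (gamma : locally_constant_cycle Q U) (t : C) : C :=
  fold_right (fun ml acc => RtoC (IZR (fst ml)) * loop_period (snd ml) t + acc)
    (RtoC 0) gamma.

(* Main.v *)
Require Import Defs.
From Stdlib Require Import Reals ZArith List Lia Lra Classical ClassicalEpsilon FunctionalExtensionality.
From Coquelicot Require Import Coquelicot.
Open Scope C_scope.

(** Write [u = z - t].  The branch satisfies [w^3 (u^2 Q(z)) = 1], hence
    [dw/dt = (2/3) w / u], and differentiating under the integral sign turns the
    left hand side of the equation into the integral along the path of
    [w (240 Q(t) / u^3 + 180 Q'(t) / u^2 + 60 Q''(t) / u + 10 Q'''(t)) dz].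
    By Taylor's formula for [Q(z)] at [t] this integrand is
    [w (240 Q(z) / u^3 - 60 Q'(z) / u^2) dz], the differential of
    [- 90 w Q(z) / u^2 = - 90 Q(z)^(2/3) u^(-8/3)], which is single valued on
    the loop.  Continuity of the branch is all that is assumed, so the
    differentiability of [w] in [t] and along the path is obtained from the
    algebraic relation. *)

(** * Landau calculus along a filter *)

(** The branch has to be expanded in two situations: [t] moves while the point of the path stays
    fixed, or the point moves while [t] stays fixed. The calculus is therefore written for an
    arbitrary filter and increment. In the first situation the remainder must be uniform along the
    path, since this is what permits differentiation under the integral; compactness of a parameter
    interval extracts that uniformity from joint continuity.

    The relation is kept in the form w^3 N = 1 with N = u^2 Q(z). Then 1/u = w^3 u Q(z) is a product
    of bounded quantities, and no lower bound for |u| along the path has to be established.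

    A path with corners admits no global primitive argument, so the work is done on one C^1 piece at
    a time and the boundary values telescope.

    The degree four enters through Taylor's formula: the u^4 terms of 240 Q(z) and of 60 u Q'(z) are
    both 240 u^4 and cancel. The factor 90 satisfies 90 * 8/3 = 240 and 90 * 2/3 = 60. *)

Definition little_o {T : Type} (G : (T -> Prop) -> Prop) (d r : T -> C) : Prop :=
  forall eps : R, (0 < eps)%R -> G (fun p => (Cmod (r p) <= eps * Cmod (d p))%R).

Definition big_O {T : Type} (G : (T -> Prop) -> Prop) (d r : T -> C) : Prop :=
  exists M : R, (0 <= M)%R /\ G (fun p => (Cmod (r p) <= M * Cmod (d p))%R).

Definition const1 {T : Type} : T -> C := fun _ => 1.

Lemma little_o_ext_loc {T : Type} (G : (T -> Prop) -> Prop) {FG : Filter G}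
  (d r r' : T -> C) :
  G (fun p => r p = r' p) -> little_o G d r -> little_o G d r'.
Proof.
intros E H eps He.
generalize (filter_and _ _ E (H eps He)); apply filter_imp.
intros p [Ep Hp]; rewrite <- Ep; exact Hp.
Qed.

Lemma little_o_ext {T : Type} (G : (T -> Prop) -> Prop) {FG : Filter G}
  (d r r' : T -> C) :
  (forall p, r p = r' p) -> little_o G d r -> little_o G d r'.
Proof.
exact (fun E => little_o_ext_loc G d r r' (filter_forall _ E)).
Qed.

Lemma big_O_ext {T : Type} (G : (T -> Prop) -> Prop) {FG : Filter G}
  (d r r' : T -> C) :
  (forall p, r p = r' p) -> big_O G d r -> big_O G d r'.
Proof.
intros E [M [HM H]]; exists M; split; [exact HM|].
revert H; apply filter_imp; intros p Hp; rewrite <- E; exact Hp.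
Qed.

Lemma little_o_big_O {T : Type} (G : (T -> Prop) -> Prop) (d r : T -> C) :
  little_o G d r -> big_O G d r.
Proof.
intros H; exists 1%R; split; [lra|exact (H 1%R Rlt_0_1)].
Qed.

Lemma little_o_plus {T : Type} (G : (T -> Prop) -> Prop) {FG : Filter G}
  (d r s : T -> C) :
  little_o G d r -> little_o G d s -> little_o G d (fun p => r p + s p).
Proof.
intros Hr Hs eps He.
assert (He2 : (0 < eps / 2)%R) by lra.
generalize (filter_and _ _ (Hr _ He2) (Hs _ He2)).
apply filter_imp; intros p [H1 H2].
generalize (Cmod_triangle (r p) (s p)); lra.
Qed.

Lemma big_O_plus {T : Type} (G : (T -> Prop) -> Prop) {FG : Filter G}
  (d r s : T -> C) :
  big_O G d r -> big_O G d s -> big_O G d (fun p => r p + s p).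
Proof.
intros [M [HM Hr]] [N [HN Hs]]; exists (M + N)%R; split; [lra|].
generalize (filter_and _ _ Hr Hs).
apply filter_imp; intros p [H1 H2].
generalize (Cmod_triangle (r p) (s p)); lra.
Qed.

Lemma big_O_mult {T : Type} (G : (T -> Prop) -> Prop) {FG : Filter G}
  (d r s : T -> C) :
  big_O G d r -> big_O G const1 s -> big_O G d (fun p => r p * s p).
Proof.
intros [M [HM Hr]] [N [HN Hs]]; exists (M * N)%R; split; [nra|].
generalize (filter_and _ _ Hr Hs).
apply filter_imp; intros p [H1 H2].
unfold const1 in H2; rewrite Cmod_1 in H2.
rewrite Cmod_mult.
apply Rle_trans with ((M * Cmod (d p)) * N)%R; [|lra].
apply Rmult_le_compat; try apply Cmod_ge_0; lra.
Qed.

Lemma little_o_mult_big_O {T : Type} (G : (T -> Prop) -> Prop) {FG : Filter G}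
  (d r s : T -> C) :
  little_o G d r -> big_O G const1 s -> little_o G d (fun p => r p * s p).
Proof.
intros Hr [N [HN Hs]] eps He.
assert (He' : (0 < eps / (N + 1))%R) by (apply Rdiv_lt_0_compat; lra).
generalize (filter_and _ _ (Hr _ He') Hs).
apply filter_imp; intros p [H1 H2].
unfold const1 in H2; rewrite Cmod_1 in H2.
rewrite Cmod_mult.
apply Rle_trans with ((eps / (N + 1) * Cmod (d p)) * (N + 1))%R.
- apply Rmult_le_compat; try apply Cmod_ge_0; lra.
- right; field; lra.
Qed.

Lemma big_O_mult_little_o {T : Type} (G : (T -> Prop) -> Prop) {FG : Filter G}
  (d r s : T -> C) :
  big_O G d r -> little_o G const1 s -> little_o G d (fun p => r p * s p).
Proof.
intros [N [HN Hr]] Hs eps He.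
assert (He' : (0 < eps / (N + 1))%R) by (apply Rdiv_lt_0_compat; lra).
generalize (filter_and _ _ Hr (Hs _ He')).
apply filter_imp; intros p [H1 H2].
unfold const1 in H2; rewrite Cmod_1 in H2.
rewrite Cmod_mult.
apply Rle_trans with ((N + 1) * Cmod (d p) * (eps / (N + 1)))%R.
- apply Rmult_le_compat; try apply Cmod_ge_0.
  + generalize (Cmod_ge_0 (d p)); nra.
  + lra.
- right; field; lra.
Qed.

Lemma big_O_trans_little_o {T : Type} (G : (T -> Prop) -> Prop) {FG : Filter G}
  (d e r : T -> C) :
  big_O G d r -> little_o G e d -> little_o G e r.
Proof.
intros [N [HN Hr]] Hs eps He.
assert (He' : (0 < eps / (N + 1))%R) by (apply Rdiv_lt_0_compat; lra).
generalize (filter_and _ _ Hr (Hs _ He')).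
apply filter_imp; intros p [H1 H2].
apply Rle_trans with ((N + 1) * (eps / (N + 1) * Cmod (e p)))%R.
- generalize (Cmod_ge_0 (d p)); nra.
- right; field; lra.
Qed.

Lemma big_O_const {T : Type} (G : (T -> Prop) -> Prop) {FG : Filter G} (c : C) :
  big_O G const1 (fun _ : T => c).
Proof.
exists (Cmod c); split; [apply Cmod_ge_0|].
apply filter_forall; intros p; unfold const1; rewrite Cmod_1; lra.
Qed.

Lemma big_O_refl {T : Type} (G : (T -> Prop) -> Prop) {FG : Filter G} (d : T -> C) :
  big_O G d d.
Proof.
exists 1%R; split; [lra|]; apply filter_forall; intros; lra.
Qed.

(** * First order expansions *)

(* [f0] and [f1] play the roles of the value and of the derivative at the base
   point; they may depend on a parameter carried by [p], in which case the
   expansion is uniform in this parameter. *)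
Definition expands {T : Type} (G : (T -> Prop) -> Prop) (d f f0 f1 : T -> C) : Prop :=
  big_O G const1 f0 /\ big_O G const1 f1 /\
  little_o G d (fun p => f p - f0 p - d p * f1 p).

Lemma expands_ext_loc {T : Type} (G : (T -> Prop) -> Prop) {FG : Filter G}
  (d f f0 f1 g g0 g1 : T -> C) :
  G (fun p => f p = g p) -> (forall p, f0 p = g0 p) -> (forall p, f1 p = g1 p) ->
  expands G d f f0 f1 -> expands G d g g0 g1.
Proof.
intros E E0 E1 [B0 [B1 H]]; repeat split.
- exact (big_O_ext _ _ _ _ E0 B0).
- exact (big_O_ext _ _ _ _ E1 B1).
- revert H; apply little_o_ext_loc; [exact FG|].
  revert E; apply filter_imp; intros p Ep; rewrite Ep, E0, E1; easy.
Qed.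

Lemma expands_ext {T : Type} (G : (T -> Prop) -> Prop) {FG : Filter G}
  (d f f0 f1 g g0 g1 : T -> C) :
  (forall p, f p = g p) -> (forall p, f0 p = g0 p) -> (forall p, f1 p = g1 p) ->
  expands G d f f0 f1 -> expands G d g g0 g1.
Proof.
exact (fun E => expands_ext_loc G d f f0 f1 g g0 g1 (filter_forall _ E)).
Qed.

Lemma expands_big_O {T : Type} (G : (T -> Prop) -> Prop) {FG : Filter G}
  (d f f0 f1 : T -> C) :
  expands G d f f0 f1 -> big_O G d (fun p => f p - f0 p).
Proof.
intros [_ [B1 H]].
apply big_O_ext with (fun p => (f p - f0 p - d p * f1 p) + d p * f1 p).
- exact FG.
- intros p; ring.
- apply big_O_plus; [exact FG|apply little_o_big_O, H|].
  apply big_O_mult; [exact FG|apply big_O_refl, FG|exact B1].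
Qed.

Lemma expands_const {T : Type} (G : (T -> Prop) -> Prop) {FG : Filter G}
  (d f : T -> C) :
  big_O G const1 f -> expands G d f f (fun _ => 0).
Proof.
intros B; repeat split; [exact B|apply big_O_const, FG|].
intros eps He; apply filter_forall; intros p.
replace (f p - f p - d p * 0) with (RtoC 0) by ring.
rewrite Cmod_0; apply Rmult_le_pos; [lra|apply Cmod_ge_0].
Qed.

Lemma expands_plus {T : Type} (G : (T -> Prop) -> Prop) {FG : Filter G}
  (d f f0 f1 g g0 g1 : T -> C) :
  expands G d f f0 f1 -> expands G d g g0 g1 ->
  expands G d (fun p => f p + g p) (fun p => f0 p + g0 p) (fun p => f1 p + g1 p).
Proof.
intros [Bf0 [Bf1 Hf]] [Bg0 [Bg1 Hg]]; repeat split; try (apply big_O_plus; assumption).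
refine (little_o_ext _ _ _ _ _ (little_o_plus _ _ _ _ Hf Hg)).
intros p; ring.
Qed.

Lemma expands_mult {T : Type} (G : (T -> Prop) -> Prop) {FG : Filter G}
  (d f f0 f1 g g0 g1 : T -> C) :
  little_o G const1 d ->
  expands G d f f0 f1 -> expands G d g g0 g1 ->
  expands G d (fun p => f p * g p) (fun p => f0 p * g0 p)
    (fun p => f1 p * g0 p + f0 p * g1 p).
Proof.
intros Hd Ef Eg.
assert (Of := expands_big_O _ _ _ _ _ Ef).
assert (Og := expands_big_O _ _ _ _ _ Eg).
destruct Ef as [Bf0 [Bf1 Hf]]; destruct Eg as [Bg0 [Bg1 Hg]]; repeat split.
- apply big_O_mult; assumption.
- apply big_O_plus; [exact FG|apply big_O_mult; assumption..].
(* Besides two linear terms, the remainder of a product contains the quadratic term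
   [(f - f0) (g - g0)]. It is a big O of [d] times a factor that tends to 0 because [d] does. *)
- apply little_o_ext with (fun p => (f p - f0 p - d p * f1 p) * g0 p
    + (g p - g0 p - d p * g1 p) * f0 p + (f p - f0 p) * (g p - g0 p)).
  + exact FG.
  + intros p; ring.
  + repeat apply little_o_plus; try exact FG.
    * apply little_o_mult_big_O; assumption.
    * apply little_o_mult_big_O; assumption.
    * apply big_O_mult_little_o; [exact FG|exact Of|].
      exact (big_O_trans_little_o _ _ _ _ Og Hd).
Qed.

(* Subtracting the two relations gives
   [(w - w0) A = - w0^4 (N - N0)] with [A = (w^2 + w w0 + w0^2) N w0 -> 3]. *)
Lemma expands_cube_root {T : Type} (G : (T -> Prop) -> Prop) {FG : Filter G}
  (d w w0 N N0 N1 : T -> C) :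
  little_o G const1 d -> expands G d N N0 N1 ->
  big_O G const1 w0 -> little_o G const1 (fun p => w p - w0 p) ->
  G (fun p => w p ^ 3 * N p = 1) -> G (fun p => w0 p ^ 3 * N0 p = 1) ->
  expands G d w w0 (fun p => - / 3 * (w0 p * w0 p * w0 p * w0 p) * N1 p).
Proof.
intros Hd EN Bw0 Hw Ew Ew0.
assert (ON := expands_big_O _ _ _ _ _ EN).
assert (LN := big_O_trans_little_o _ _ _ _ ON Hd).
destruct EN as [BN0 [BN1 HN]].
assert (B4 : big_O G const1 (fun p => w0 p * w0 p * w0 p * w0 p))
  by (repeat apply big_O_mult; assumption).
assert (Bc := fun c => big_O_const G c).
set (A := fun p => (w p * w p + w p * w0 p + w0 p * w0 p) * N p * w0 p).
assert (LA : little_o G const1 (fun p => A p - 3)).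
(* Writing 3 as 3 w0^3 N0 leaves a factor [w - w0] or [N - N0] in every term of the difference. *)
{ apply little_o_ext_loc with (fun p =>
    (w p - w0 p) * ((w p + 2 * w0 p) * w0 p * N p)
    + (N p - N0 p) * (3 * w0 p * w0 p * w0 p)).
  - exact FG.
  - revert Ew0; apply filter_imp; intros p E.
    transitivity (A p - 3 * (w0 p ^ 3 * N0 p)); unfold A; [ring|rewrite E; ring].
  - assert (BN : big_O G const1 N).
    { apply big_O_ext with (fun p => (N p - N0 p) + N0 p);
        [exact FG|intros; ring|].
      apply big_O_plus; [exact FG|apply little_o_big_O; assumption|exact BN0]. }
    assert (Bw : big_O G const1 w).
    { apply big_O_ext with (fun p => (w p - w0 p) + w0 p);
        [exact FG|intros; ring|].
      apply big_O_plus; [exact FG|apply little_o_big_O; assumption|exact Bw0]. }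
    apply little_o_plus; [exact FG|apply little_o_mult_big_O; auto..].
    all: repeat (apply big_O_mult || apply big_O_plus); auto. }
assert (Key : G (fun p => (w p - w0 p) * A p
                 = - ((N p - N0 p) * (w0 p * w0 p * w0 p * w0 p)))).
{ generalize (filter_and _ _ Ew Ew0); apply filter_imp; intros p [E E0].
  unfold A.
  transitivity (w0 p * (w p ^ 3 * N p - w0 p ^ 3 * N0 p)
    - (N p - N0 p) * (w0 p * w0 p * w0 p * w0 p)); [ring|].
  rewrite E, E0; ring. }
(* A bootstrap: [A] is eventually within 1 of 3, hence of modulus at least 2, and [Key] then
   improves [w - w0] from o(1) to O(d). *)
assert (Ow : big_O G d (fun p => w p - w0 p)).
{ destruct (big_O_mult _ _ _ _ ON B4) as [M [HM H]].
  exists M; split; [exact HM|].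
  generalize (filter_and _ _ (filter_and _ _ H Key) (LA 1%R Rlt_0_1)).
  apply filter_imp; intros p [[H1 H2] H3].
  unfold const1 in H3; rewrite Cmod_1 in H3.
  assert (HA : (2 <= Cmod (A p))%R).
  { generalize (Cmod_triangle (A p) (3 - A p)).
    replace (A p + (3 - A p)) with (RtoC 3) by ring.
    rewrite Cmod_R, Rabs_pos_eq by lra.
    replace (3 - A p) with (- (A p - 3)) by ring; rewrite Cmod_opp; lra. }
  apply Rle_trans with (Cmod (w p - w0 p) * Cmod (A p))%R.
  - generalize (Cmod_ge_0 (w p - w0 p)); nra.
  - rewrite <- Cmod_mult, H2, Cmod_opp; exact H1. }
repeat split.
- exact Bw0.
- repeat apply big_O_mult; auto.
(* By [Key], 3 (w - w0) equals - (N - N0) w0^4 - (w - w0) (A - 3), and the last product is O(d)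
   times o(1). *)
- apply little_o_ext_loc with (fun p =>
    ((w p - w0 p) * (A p - 3)
     + (N p - N0 p - d p * N1 p) * (w0 p * w0 p * w0 p * w0 p)) * (- / 3)).
  + exact FG.
  + revert Key; apply filter_imp; intros p E.
    replace ((w p - w0 p) * (A p - 3)) with ((w p - w0 p) * A p - 3 * (w p - w0 p))
      by ring.
    rewrite E; field.
  + apply little_o_mult_big_O; [exact FG| |exact (Bc (- / 3))].
    apply little_o_plus; [exact FG| |apply little_o_mult_big_O; assumption].
    apply big_O_mult_little_o; assumption.
Qed.

(** * Derivatives and integrals *)

Lemma is_derive_of_expands (f : C -> C) (t l : C) :
  expands (locally (T := AbsRing_UniformSpace C_AbsRing) t)
    (fun x => x - t) f (fun _ => f t) (fun _ => l) ->
  is_derive (K := C_AbsRing) (V := C_NormedModule) f t l.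
Proof.
intros [_ [_ H]]; split; [apply is_linear_scal_l|].
intros x Hx.
apply (is_filter_lim_locally_unique (V := AbsRing_NormedModule C_AbsRing)) in Hx; subst x.
intros eps; exact (H eps (cond_pos eps)).
Qed.

Lemma scal_RtoC (r : R) (z : C) : scal (V := C_R_NormedModule) r z = RtoC r * z.
Proof.
apply injective_projections; simpl; unfold scal; simpl; unfold mult; simpl; ring.
Qed.

(** The real increment is embedded in [C] so that differentiation along the path runs through the
    same calculus as differentiation in [t]. *)
Lemma expands_of_is_derive (h : R -> C) (x : R) (l : C) :
  is_derive (K := R_AbsRing) (V := C_R_NormedModule) h x l ->
  expands (locally x) (fun y => RtoC (y - x)) h (fun _ => h x) (fun _ => l).
Proof.
intros [_ H]; repeat split; [apply big_O_const, locally_filter..|].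
intros eps He.
generalize (H x (fun P HP => HP) (mkposreal eps He)).
apply filter_imp; intros y Hy.
rewrite Cmod_R, Cmod_norm, <- scal_RtoC.
exact Hy.
Qed.

Lemma is_derive_of_expands_R (f : R -> C) (x : R) (l : C) :
  expands (locally x) (fun y => RtoC (y - x)) f (fun _ => f x) (fun _ => l) ->
  is_derive (K := R_AbsRing) (V := C_R_NormedModule) f x l.
Proof.
intros [_ [_ H]]; split; [apply is_linear_scal_l|].
intros x' Hx; apply (is_filter_lim_locally_unique (V := AbsRing_NormedModule R_AbsRing)) in Hx; subst x'.
intros eps; generalize (H eps (cond_pos eps)).
apply filter_imp; intros y Hy.
rewrite Cmod_R, Cmod_norm, <- scal_RtoC in Hy.
exact Hy.
Qed.

Lemma is_derive_fst (f : R -> C) (x : R) (l : C) :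
  is_derive (K := R_AbsRing) (V := C_R_NormedModule) f x l ->
  is_derive (fun y => fst (f y)) x (fst l).
Proof.
intros H.
exact (filterdiff_comp' f (fun z : C_R_NormedModule => fst z) x _ _ H
  (filterdiff_linear _ is_linear_fst)).
Qed.

Lemma is_derive_snd (f : R -> C) (x : R) (l : C) :
  is_derive (K := R_AbsRing) (V := C_R_NormedModule) f x l ->
  is_derive (fun y => snd (f y)) x (snd l).
Proof.
intros H.
exact (filterdiff_comp' f (fun z : C_R_NormedModule => snd z) x _ _ H
  (filterdiff_linear _ is_linear_snd)).
Qed.

Lemma continuous_C_fst (f : R -> C) (x : R) :
  continuous (U := C_UniformSpace) f x -> continuous (fun y => fst (f y)) x.
Proof.
intros H.
apply (continuous_comp (V := C_UniformSpace) f fst); [exact H|].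
destruct (f x); apply continuous_fst.
Qed.

Lemma continuous_C_snd (f : R -> C) (x : R) :
  continuous (U := C_UniformSpace) f x -> continuous (fun y => snd (f y)) x.
Proof.
intros H.
apply (continuous_comp (V := C_UniformSpace) f snd); [exact H|].
destruct (f x); apply continuous_snd.
Qed.

Lemma continuous_C_pair (f : R -> C) (x : R) :
  continuous (fun y => fst (f y)) x -> continuous (fun y => snd (f y)) x ->
  continuous (U := C_UniformSpace) f x.
Proof.
intros H1 H2 P [e HP].
assert (L1 := H1 _ (locally_ball (fst (f x)) e)).
assert (L2 := H2 _ (locally_ball (snd (f x)) e)).
unfold filtermap in L1, L2 |- *.
generalize (filter_and _ _ L1 L2).
apply filter_imp; intros y [Hy1 Hy2]; apply HP; split; assumption.
Qed.

Lemma continuous_C_plus (f g : R -> C) (x : R) :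
  continuous (U := C_UniformSpace) f x -> continuous (U := C_UniformSpace) g x ->
  continuous (U := C_UniformSpace) (fun y => f y + g y) x.
Proof.
exact (continuous_plus (V := C_R_NormedModule) f g x).
Qed.

Lemma continuous_C_mult (f g : R -> C) (x : R) :
  continuous (U := C_UniformSpace) f x -> continuous (U := C_UniformSpace) g x ->
  continuous (U := C_UniformSpace) (fun y => f y * g y) x.
Proof.
intros Hf Hg.
assert (F1 := continuous_C_fst _ _ Hf); assert (F2 := continuous_C_snd _ _ Hf).
assert (G1 := continuous_C_fst _ _ Hg); assert (G2 := continuous_C_snd _ _ Hg).
apply continuous_C_pair; simpl.
- apply (continuous_minus (V := R_NormedModule));
    apply (continuous_mult (K := R_AbsRing)); assumption.
- apply (continuous_plus (V := R_NormedModule));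
    apply (continuous_mult (K := R_AbsRing)); assumption.
Qed.

(** The scalars of [C_R_NormedModule] are real, whereas a complex factor mixes real and imaginary
    parts; the two components are therefore integrated separately. *)
Lemma is_RInt_Cmult (c : C) (f : R -> C) (a b : R) (l : C) :
  is_RInt (V := C_R_NormedModule) f a b l ->
  is_RInt (V := C_R_NormedModule) (fun s => c * f s) a b (c * l).
Proof.
intros H.
assert (H1 := is_RInt_fct_extend_fst _ _ _ _ H).
assert (H2 := is_RInt_fct_extend_snd _ _ _ _ H).
apply (is_RInt_fct_extend_pair (U := R_NormedModule) (V := R_NormedModule)).
- exact (is_RInt_minus _ _ _ _ _ _ (is_RInt_scal _ _ _ (fst c) _ H1)
    (is_RInt_scal _ _ _ (snd c) _ H2)).
- exact (is_RInt_plus _ _ _ _ _ _ (is_RInt_scal _ _ _ (fst c) _ H2)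
    (is_RInt_scal _ _ _ (snd c) _ H1)).
Qed.

(** [F] minus the running integral of [f] is continuous with zero derivative inside, so the mean
    value theorem makes it constant. The derivative is requested only in the open interval because a
    path frozen outside a piece may have corners at its ends. *)
Lemma is_RInt_open_derive_R (F f : R -> R) (a b : R) :
  (a <= b)%R -> (forall x, continuous F x) -> (forall x, continuous f x) ->
  (forall x, (a < x < b)%R -> is_derive F x (f x)) ->
  is_RInt f a b (F b - F a)%R.
Proof.
intros Hab CF Cf D.
assert (Hint : forall x, ex_RInt f a x)
  by (intros x; apply (ex_RInt_continuous (V := R_CompleteNormedModule)); auto).
assert (DG : forall x, is_derive (fun y => RInt f a y) x (f x)).
{ intros x; apply (is_derive_RInt f _ a); [|apply Cf].
  apply filter_forall; intros y; apply (RInt_correct (V := R_CompleteNormedModule)), Hint. }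
destruct (MVT_gen (fun x => F x - RInt f a x)%R a b (fun _ => 0%R)) as [c [_ E]].
- rewrite Rmin_left, Rmax_right by exact Hab; intros x Hx.
  replace 0%R with (f x - f x)%R by ring.
  exact (is_derive_minus _ _ _ _ _ (D x Hx) (DG x)).
- intros x _; apply continuity_pt_minus.
  + apply continuity_pt_filterlim, CF.
  + apply continuity_pt_filterlim.
    apply (ex_derive_continuous (V := R_NormedModule) (fun y => RInt f a y)).
    eexists; apply DG.
- rewrite RInt_point in E; unfold zero in E; simpl in E.
  replace (F b - F a)%R with (RInt f a b) by lra.
  apply (RInt_correct (V := R_CompleteNormedModule)), Hint.
Qed.

Lemma is_RInt_open_derive (F f : R -> C) (a b : R) :
  (a <= b)%R -> (forall x, continuous (U := C_UniformSpace) F x) ->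
  (forall x, continuous (U := C_UniformSpace) f x) ->
  (forall x, (a < x < b)%R ->
     is_derive (K := R_AbsRing) (V := C_R_NormedModule) F x (f x)) ->
  is_RInt (V := C_R_NormedModule) f a b (F b - F a).
Proof.
intros Hab CF Cf D.
apply (is_RInt_fct_extend_pair (U := R_NormedModule) (V := R_NormedModule)).
- apply (is_RInt_open_derive_R (fun x => fst (F x))); [exact Hab| | |];
    intros; [apply continuous_C_fst; auto..|apply is_derive_fst; auto].
- apply (is_RInt_open_derive_R (fun x => snd (F x))); [exact Hab| | |];
    intros; [apply continuous_C_snd; auto..|apply is_derive_snd; auto].
Qed.

(* The filter of uniform convergence on [a, b] as the parameter tends to [t]. *)
Definition strip (a b : R) (t : C) (P : C * R -> Prop) : Prop :=
  exists r : R, (0 < r)%R /\ forall (u : C) (s : R),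
    (Cmod (u - t) < r)%R -> (a <= s <= b)%R -> P (u, s).

Global Instance strip_filter (a b : R) (t : C) : Filter (strip a b t).
Proof.
split.
- exists 1%R; split; [lra|easy].
- intros P Q [r [Hr HP]] [q [Hq HQ]].
  exists (Rmin r q); split; [apply Rmin_glb_lt; assumption|].
  intros u s Hu Hs; split.
  + apply HP; [apply Rlt_le_trans with (1 := Hu), Rmin_l|exact Hs].
  + apply HQ; [apply Rlt_le_trans with (1 := Hu), Rmin_r|exact Hs].
- intros P Q HPQ [r [Hr HP]]; exists r; split; [exact Hr|].
  intros u s Hu Hs; auto.
Qed.

(** Two uniform structures live on [C]: squares, from the product, and discs, from the modulus.
    Complex derivatives and [strip] use discs; [locally_C] translates from the squares. *)
Lemma locally_Cmod (t : C) (P : C -> Prop) :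
  (exists r : R, (0 < r)%R /\ forall u, (Cmod (u - t) < r)%R -> P u) <->
  locally (T := AbsRing_UniformSpace C_AbsRing) t P.
Proof.
split.
- intros [r [Hr H]]; exists (mkposreal r Hr); intros u Hu; apply H, Hu.
- intros [r H]; exists r; split; [apply cond_pos|]; intros u Hu; apply H, Hu.
Qed.

Lemma strip_param (a b : R) (t : C) (P : C -> Prop) :
  locally (T := AbsRing_UniformSpace C_AbsRing) t P ->
  strip a b t (fun p => P (fst p)).
Proof.
intros H; apply locally_Cmod in H; destruct H as [r [Hr H]].
exists r; split; [exact Hr|]; intros u s Hu _; exact (H u Hu).
Qed.

Lemma strip_path (a b : R) (t : C) (P : R -> Prop) :
  (forall s, (a <= s <= b)%R -> P s) -> strip a b t (fun p => P (snd p)).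
Proof.
intros H; exists 1%R; split; [lra|]; intros u s _ Hs; exact (H s Hs).
Qed.

Lemma strip_increment (a b : R) (t : C) :
  little_o (strip a b t) const1 (fun p => fst p - t).
Proof.
intros eps He; exists eps; split; [exact He|].
intros u s Hu _; unfold const1; simpl; rewrite Cmod_1; lra.
Qed.

Lemma strip_continuous_bounded (a b : R) (t : C) (f : R -> C) :
  (forall s, continuous (U := C_UniformSpace) f s) ->
  big_O (strip a b t) const1 (fun p => f (snd p)).
Proof.
intros H.
destruct (bounded_continuity (V := C_R_NormedModule) f a b (fun s _ => H s)) as [M HM].
exists (Rmax 0 M); split; [apply Rmax_l|].
apply (strip_path a b t (fun s => (Cmod (f s) <= Rmax 0 M * Cmod 1)%R)).
intros s Hs; rewrite Cmod_1, Rmult_1_r.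
generalize (Rmax_r 0 M) (HM s Hs); rewrite Cmod_norm.
change (norm (f s)) with (norm (V := C_R_NormedModule) (f s)); lra.
Qed.

(** A remainder that is o(u - t) uniformly in [s] is still o(u - t) once integrated over a bounded
    interval, and the linear term integrates to the claimed derivative. *)
Lemma is_derive_RInt_strip (f : C -> R -> C) (f1 : R -> C) (a b : R) (t : C) :
  (a <= b)%R ->
  locally (T := AbsRing_UniformSpace C_AbsRing) t
    (fun u => ex_RInt (V := C_R_NormedModule) (f u) a b) ->
  ex_RInt (V := C_R_NormedModule) f1 a b ->
  expands (strip a b t) (fun p => fst p - t) (fun p => f (fst p) (snd p))
    (fun p => f t (snd p)) (fun p => f1 (snd p)) ->
  is_derive (K := C_AbsRing) (V := C_NormedModule)
    (fun u => RInt (V := C_R_CompleteNormedModule) (f u) a b) t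
    (RInt (V := C_R_CompleteNormedModule) f1 a b).
Proof.
intros Hab Hf Hf1 [_ [_ H]].
apply is_derive_of_expands; repeat split; [apply big_O_const, locally_filter..|].
intros eps He.
(* The added 1 keeps the divisor positive when [a = b]. *)
assert (He' : (0 < eps / (b - a + 1))%R) by (apply Rdiv_lt_0_compat; lra).
apply locally_Cmod in Hf; destruct Hf as [r [Hr Hf]].
destruct (H _ He') as [q [Hq Hs]].
apply locally_Cmod; exists (Rmin r q); split; [apply Rmin_glb_lt; assumption|].
intros u Hu.
assert (Ht : ex_RInt (V := C_R_NormedModule) (f t) a b).
{ apply Hf; replace (t - t) with (RtoC 0) by ring; rewrite Cmod_0; exact Hr. }
assert (Hur : ex_RInt (V := C_R_NormedModule) (f u) a b)
  by (apply Hf, Rlt_le_trans with (1 := Hu), Rmin_l).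
apply (RInt_correct (V := C_R_CompleteNormedModule)) in Ht.
apply (RInt_correct (V := C_R_CompleteNormedModule)) in Hur.
apply (RInt_correct (V := C_R_CompleteNormedModule)) in Hf1.
assert (Hd := is_RInt_minus (V := C_R_NormedModule) _ _ _ _ _ _
  (is_RInt_minus (V := C_R_NormedModule) _ _ _ _ _ _ Hur Ht)
  (is_RInt_Cmult (u - t) _ _ _ _ Hf1)).
assert (Bs : forall s, (a <= s <= b)%R ->
  (norm (V := C_R_NormedModule)
     (minus (minus (f u s) (f t s)) (Cmult (u - t) (f1 s)))
   <= eps / (b - a + 1) * Cmod (u - t))%R).
{ intros s Hsab; rewrite <- Cmod_norm.
  exact (Hs u s (Rlt_le_trans _ _ _ Hu (Rmin_r r q)) Hsab). }
assert (B := norm_RInt_le_const _ _ _ _ _ Hab Bs Hd).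
rewrite <- Cmod_norm in B.
apply Rle_trans with (1 := B).
apply Rle_trans with ((b - a + 1) * (eps / (b - a + 1) * Cmod (u - t)))%R.
- apply Rmult_le_compat_r; [|lra].
  apply Rmult_le_pos; [lra|apply Cmod_ge_0].
- right; field; lra.
Qed.

(* Heine's argument: joint continuity along the compact [{t} x [a, b]] is
   uniform in the second variable. *)
Lemma strip_joint_continuous (D : C * R -> Prop) (w : C -> R -> C) (a b : R) (t : C) :
  (forall s, (a <= s <= b)%R -> D (t, s)) ->
  (forall s, (a <= s <= b)%R ->
    filterlim (fun p : C * R => w (fst p) (snd p))
      (within D (locally (T := prod_UniformSpace C_UniformSpace R_UniformSpace) (t, s)))
      (locally (T := C_UniformSpace) (w t s))) ->
  strip a b t D ->
  little_o (strip a b t) const1 (fun p => w (fst p) (snd p) - w t (snd p)).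
Proof.
intros Dt Hw [r [Hr HD]] eps He.
assert (Hloc : forall s, exists d : posreal, (a <= s <= b)%R ->
  forall u x, (Cmod (u - t) < d)%R -> (Rabs (x - s) < d)%R -> D (u, x) ->
    (Cmod (w u x - w t s) < eps / 2)%R).
{ intros s.
  destruct (classic (a <= s <= b)%R) as [Hs|Hs];
    [|exists (mkposreal 1 Rlt_0_1); contradiction].
  assert (HL : locally (T := C_UniformSpace) (w t s)
    (fun z => (Cmod (z - w t s) < eps / 2)%R)).
  { apply locally_C, locally_Cmod; exists (eps / 2)%R; split; [lra|easy]. }
  destruct (Hw s Hs _ HL) as [d Hd].
  exists d; intros _ u x Hu Hx Hux; apply (Hd (u, x)); [|exact Hux].
  split; [|exact Hx].
  apply C_NormedModule_mixin_compat1; exact Hu. }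
(* The radii must form a function of the centre for [compactness_value_1d]. It returns an [e] such
   that every [x] is, up to a double negation, within the radius of some centre whose radius is at
   least [e]. *)
pose (d := fun s => proj1_sig (constructive_indefinite_description _ (Hloc s))).
destruct (compactness_value_1d a b d) as [e He'].
exists (Rmin r e); split; [apply Rmin_glb_lt; [exact Hr|apply cond_pos]|].
intros u x Hu Hx; unfold const1; simpl; rewrite Cmod_1, Rmult_1_r.
apply NNPP; intros Hn; apply (He' x Hx); intros [s [Hs [Hxs Hes]]]; apply Hn.
assert (P := proj2_sig (constructive_indefinite_description _ (Hloc s)) Hs).
fold (d s) in P; simpl in P.
assert (Hue : (Cmod (u - t) < d s)%R)
  by (apply Rlt_le_trans with (2 := Hes), Rlt_le_trans with (1 := Hu), Rmin_r).
assert (P1 := P u x Hue Hxs (HD u x (Rlt_le_trans _ _ _ Hu (Rmin_l _ _)) Hx)).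
assert (P2 : (Cmod (w t x - w t s) < eps / 2)%R).
{ apply P; [|exact Hxs|exact (Dt x Hx)].
  replace (t - t) with (RtoC 0) by ring; rewrite Cmod_0; apply cond_pos. }
(* Both values are compared with the value at the centre [(t, s)], each at a cost of eps / 2. *)
replace (w u x - w t x) with ((w u x - w t s) + - (w t x - w t s)) by ring.
generalize (Cmod_triangle (w u x - w t s) (- (w t x - w t s))).
rewrite Cmod_opp; lra.
Qed.

(** * The quartic *)

Definition quartic1 (a3 a2 a1 t : C) : C := 4 * t ^ 3 + 3 * a3 * t ^ 2 + 2 * a2 * t + a1.
Definition quartic2 (a3 a2 t : C) : C := 12 * t ^ 2 + 6 * a3 * t + 2 * a2.
Definition quartic3 (a3 t : C) : C := 24 * t + 6 * a3.

(** Horner's form reduces this to sums and products. Expanding [z] as well covers three uses: [z]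
    constant while [t] moves, [z] moving along the path, and [z] the variable of the polynomial
    itself. *)
Lemma expands_quartic {T : Type} (G : (T -> Prop) -> Prop) {FG : Filter G}
  (a3 a2 a1 a0 : C) (d z z0 z1 : T -> C) :
  little_o G const1 d -> expands G d z z0 z1 ->
  expands G d (fun p => quartic a3 a2 a1 a0 (z p))
    (fun p => quartic a3 a2 a1 a0 (z0 p)) (fun p => quartic1 a3 a2 a1 (z0 p) * z1 p).
Proof.
intros Hd Hz.
assert (Hc := fun c : C => expands_const G d (fun _ => c) (big_O_const G c)).
refine (expands_ext _ _ _ _ _ _ _ _ _ _ _
  (expands_plus _ _ _ _ _ _ _ _ (expands_mult _ _ _ _ _ _ _ _ Hd
  (expands_plus _ _ _ _ _ _ _ _ (expands_mult _ _ _ _ _ _ _ _ Hd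
  (expands_plus _ _ _ _ _ _ _ _ (expands_mult _ _ _ _ _ _ _ _ Hd
  (expands_plus _ _ _ _ _ _ _ _ Hz (Hc a3)) Hz) (Hc a2)) Hz) (Hc a1)) Hz) (Hc a0)));
  intros p; unfold quartic, quartic1; simpl; ring.
Qed.

Ltac continuity_C :=
  repeat match goal with
  | |- continuous (fun x => Cplus _ _) _ => apply continuous_C_plus
  | |- continuous (fun x => Cminus _ _) _ => apply continuous_C_plus
  | |- continuous (fun x => Cmult _ _) _ => apply continuous_C_mult
  end; try assumption; try apply continuous_const.

Lemma continuous_quartic (a3 a2 a1 a0 : C) (z : R -> C) (s : R) :
  continuous (U := C_UniformSpace) z s ->
  continuous (U := C_UniformSpace) (fun x => quartic a3 a2 a1 a0 (z x)) s.
Proof.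
intros Hz.
apply (continuous_ext (T := R_UniformSpace) (U := C_UniformSpace)
  (fun x => (((z x + a3) * z x + a2) * z x + a1) * z x + a0)).
- intros x; unfold quartic; simpl; ring.
- continuity_C.
Qed.


(** * The multivalued integrand *)

Lemma expands_increment {T : Type} (G : (T -> Prop) -> Prop) {FG : Filter G} (d : T -> C) :
  expands G d d (fun _ => 0) (fun _ => 1).
Proof.
repeat split; [apply big_O_const, FG..|].
intros eps He; apply filter_forall; intros p.
replace (d p - 0 - d p * 1) with (RtoC 0) by ring.
rewrite Cmod_0; apply Rmult_le_pos; [lra|apply Cmod_ge_0].
Qed.

(** This expression of the inverse as a monomial lets continuity and expansions of 1/u follow from
    those of products. *)
Lemma Cinv_of_branch (w u q : C) : w ^ 3 * (u * u * q) = 1 -> / u = w * w * w * u * q.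
Proof.
intros E.
assert (Hu : u <> 0).
{ intros ->; apply C1_nz; rewrite <- E; ring. }
transitivity (/ u * (w ^ 3 * (u * u * q))); [rewrite E; ring|].
field; exact Hu.
Qed.

(** Logarithmic differentiation of w^3 u^2 q = 1 gives dw/w = - (2 du/u + dq/q) / 3. With [u1 = -1]
    and [q1 = 0] it yields the derivative in [t]; with [u1] the velocity of the path it yields the
    derivative along the path. *)
Lemma expands_branch {T : Type} (G : (T -> Prop) -> Prop) {FG : Filter G}
  (d w w0 u u0 u1 q q0 q1 : T -> C) :
  little_o G const1 d -> expands G d u u0 u1 -> expands G d q q0 q1 ->
  big_O G const1 w0 -> little_o G const1 (fun p => w p - w0 p) ->
  G (fun p => w p ^ 3 * (u p * u p * q p) = 1) ->
  (forall p, w0 p ^ 3 * (u0 p * u0 p * q0 p) = 1) ->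
  expands G d w w0
    (fun p => - / 3 * w0 p * (2 * u1 p * / u0 p + q1 p * / q0 p)) /\
  expands G d (fun p => / u p) (fun p => / u0 p) (fun p => - u1 p * (/ u0 p * / u0 p)).
Proof.
intros Hd Hu Hq Bw0 Lw Ew Ew0.
assert (Nz : forall p, u0 p <> 0 /\ q0 p <> 0).
{ intros p; split; intros E; apply C1_nz; rewrite <- (Ew0 p), E; ring. }
assert (HN := expands_mult _ _ _ _ _ _ _ _ Hd (expands_mult _ _ _ _ _ _ _ _ Hd Hu Hu) Hq).
assert (Hw := expands_cube_root _ _ _ _ _ _ _ Hd HN Bw0 Lw Ew (filter_forall _ Ew0)).
assert (Hw' : expands G d w w0
    (fun p => - / 3 * w0 p * (2 * u1 p * / u0 p + q1 p * / q0 p))).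
{ refine (expands_ext _ _ _ _ _ _ _ _ _ _ _ Hw); [reflexivity..|].
  intros p; destruct (Nz p) as [N1 N2]; simpl.
  transitivity (- / 3 * w0 p * (w0 p ^ 3 * (u0 p * u0 p * q0 p))
    * (2 * u1 p * / u0 p + q1 p * / q0 p)).
  - field; repeat split; assumption.
  - rewrite Ew0; ring. }
split; [exact Hw'|].
(* The inverse is expanded as the product w w w u q. For the moving branch this equality is only
   known along the filter, hence the local form of extensionality. *)
refine (expands_ext_loc _ _ _ _ _ _ _ _ _ _ _ (expands_mult _ _ _ _ _ _ _ _ Hd
  (expands_mult _ _ _ _ _ _ _ _ Hd (expands_mult _ _ _ _ _ _ _ _ Hd
  (expands_mult _ _ _ _ _ _ _ _ Hd Hw' Hw') Hw') Hu) Hq)).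
- revert Ew; apply filter_imp; intros p E; symmetry; exact (Cinv_of_branch _ _ _ E).
- intros p; symmetry; exact (Cinv_of_branch _ _ _ (Ew0 p)).
- intros p; destruct (Nz p) as [N1 N2]; simpl.
  transitivity (- (w0 p ^ 3 * (u0 p * u0 p * q0 p)) * u1 p * (/ u0 p * / u0 p)).
  + field; repeat split; assumption.
  + rewrite Ew0; ring.
Qed.

(* The path and the branch over a piece [a, b] are prolonged by constants to all
   [s : R], which makes continuity two-sided at the end points. *)
Record branch_piece (Q : C -> C) (U : C -> Prop) (a b : R) (z dz : R -> C)
    (w : C -> R -> C) : Prop := {
  piece_le : (a <= b)%R;
  piece_path : forall s, continuous (U := C_UniformSpace) z s;
  piece_velocity : forall s, continuous (U := C_UniformSpace) dz s;
  piece_derive : forall s, (a < s < b)%R ->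
    is_derive (K := R_AbsRing) (V := C_R_NormedModule) z s (dz s);
  piece_branch : forall t s, U t -> w t s ^ 3 * ((z s - t) * (z s - t) * Q (z s)) = 1;
  piece_continuous : forall t s, U t -> continuous (U := C_UniformSpace) (w t) s;
  piece_uniform : forall t, U t ->
    little_o (strip a b t) const1 (fun p => w (fst p) (snd p) - w t (snd p))
}.

(** The family is closed under differentiation in [t], up to constants: each derivative raises [k]
    by one, starting from the integrand of the period at [k = 0]. *)
Definition kernel (z : R -> C) (w : C -> R -> C) (k : nat) (t : C) (s : R) : C :=
  w t s * (/ (z s - t)) ^ k.

Lemma continuous_inv_piece (a3 a2 a1 a0 : C) (U : C -> Prop) (a b : R) (z dz : R -> C)
  (w : C -> R -> C) (t : C) (s : R) :
  branch_piece (quartic a3 a2 a1 a0) U a b z dz w -> U t ->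
  continuous (U := C_UniformSpace) (fun x => / (z x - t)) s.
Proof.
intros P Ht.
apply (continuous_ext (T := R_UniformSpace) (U := C_UniformSpace)
  (fun x => w t x * w t x * w t x * (z x - t) * quartic a3 a2 a1 a0 (z x))).
- intros x; symmetry; apply Cinv_of_branch, (piece_branch _ _ _ _ _ _ _ P), Ht.
- assert (Cw := piece_continuous _ _ _ _ _ _ _ P t s Ht).
  assert (Cz := piece_path _ _ _ _ _ _ _ P s).
  continuity_C.
  apply continuous_quartic, Cz.
Qed.

Lemma continuous_kernel (a3 a2 a1 a0 : C) (U : C -> Prop) (a b : R) (z dz : R -> C)
  (w : C -> R -> C) (k : nat) (t : C) (s : R) :
  branch_piece (quartic a3 a2 a1 a0) U a b z dz w -> U t ->
  continuous (U := C_UniformSpace) (kernel z w k t) s.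
Proof.
intros P Ht.
apply continuous_C_mult; [exact (piece_continuous _ _ _ _ _ _ _ P t s Ht)|].
assert (Ci := continuous_inv_piece _ _ _ _ _ _ _ _ _ _ t s P Ht).
induction k as [|k IH]; simpl.
- apply continuous_const.
- apply continuous_C_mult; assumption.
Qed.

(** The branch contributes 2/3 to the coefficient, because u^2 has exponent -1/3 in it and du/dt =
    -1; by induction each further factor 1/u contributes 1. *)
Lemma expands_kernel (a3 a2 a1 a0 : C) (U : C -> Prop) (a b : R) (z dz : R -> C)
  (w : C -> R -> C) (k : nat) (t : C) :
  open (T := C_UniformSpace) U ->
  branch_piece (quartic a3 a2 a1 a0) U a b z dz w -> U t ->
  expands (strip a b t) (fun p => fst p - t)
    (fun p => kernel z w k (fst p) (snd p)) (fun p => kernel z w k t (snd p))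
    (fun p => RtoC (2 / 3 + INR k) * kernel z w (S k) t (snd p)).
Proof.
intros HU P Ht.
assert (Hd := strip_increment a b t).
assert (Hc := fun c : C => expands_const (strip a b t) (fun p => fst p - t) (fun _ => c)
  (big_O_const (strip a b t) c)).
assert (Hz := expands_const (strip a b t) (fun p => fst p - t) (fun p => z (snd p))
  (strip_continuous_bounded a b t z (piece_path _ _ _ _ _ _ _ P))).
assert (Hq := expands_quartic _ a3 a2 a1 a0 _ _ _ _ Hd Hz).
assert (Hu : expands (strip a b t) (fun p => fst p - t) (fun p => z (snd p) - fst p)
  (fun p => z (snd p) - t) (fun _ => - (1))).
{ refine (expands_ext _ _ _ _ _ _ _ _ _ _ _
    (expands_plus _ _ _ _ _ _ _ _ (expands_plus _ _ _ _ _ _ _ _ Hz (Hc (- t)))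
      (expands_mult _ _ _ _ _ _ _ _ Hd (Hc (- (1))) (expands_increment _ _))));
    intros p; simpl; ring. }
assert (UL : strip a b t (fun p => U (fst p)))
  by (apply strip_param, locally_C, HU, Ht).
destruct (expands_branch _ _ (fun p => w (fst p) (snd p)) (fun p => w t (snd p))
  _ _ _ _ _ _ Hd Hu Hq) as [Hw Hi].
- apply strip_continuous_bounded; intros s; exact (piece_continuous _ _ _ _ _ _ _ P t s Ht).
- exact (piece_uniform _ _ _ _ _ _ _ P t Ht).
- revert UL; apply filter_imp; intros p Hp; exact (piece_branch _ _ _ _ _ _ _ P _ _ Hp).
- intros p; exact (piece_branch _ _ _ _ _ _ _ P _ _ Ht).
- induction k as [|k IH].
  + refine (expands_ext _ _ _ _ _ _ _ _ _ _ _ Hw);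
      intros p; unfold kernel; simpl; [ring..|].
    rewrite Rplus_0_r, RtoC_div by lra.
    field; repeat split; try assumption; intros E; apply C1_nz;
      rewrite <- (piece_branch _ _ _ _ _ _ _ P t (snd p) Ht), E; ring.
  + assert (H := expands_mult (strip a b t) _ _ _ _ _ _ _ Hd IH Hi).
    refine (expands_ext _ _ _ _ _ _ _ _ _ _ _ H);
      intros p; unfold kernel; [simpl; ring..|].
    rewrite S_INR, !RtoC_plus; simpl; ring.
Qed.

Definition piece_period (a b : R) (z dz : R -> C) (w : C -> R -> C) (k : nat) (t : C) : C :=
  RInt (V := C_R_CompleteNormedModule) (fun s => kernel z w k t s * dz s) a b.

Lemma is_RInt_piece_period (a3 a2 a1 a0 : C) (U : C -> Prop) (a b : R) (z dz : R -> C)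
  (w : C -> R -> C) (k : nat) (t : C) :
  branch_piece (quartic a3 a2 a1 a0) U a b z dz w -> U t ->
  is_RInt (V := C_R_NormedModule) (fun s => kernel z w k t s * dz s) a b
    (piece_period a b z dz w k t).
Proof.
intros P Ht.
apply (RInt_correct (V := C_R_CompleteNormedModule)),
  (ex_RInt_continuous (V := C_R_CompleteNormedModule)); intros s _.
apply continuous_C_mult; [|exact (piece_velocity _ _ _ _ _ _ _ P s)].
exact (continuous_kernel _ _ _ _ _ _ _ _ _ _ k t s P Ht).
Qed.

Lemma is_derive_piece_period (a3 a2 a1 a0 : C) (U : C -> Prop) (a b : R) (z dz : R -> C)
  (w : C -> R -> C) (k : nat) (t : C) :
  open (T := C_UniformSpace) U ->
  branch_piece (quartic a3 a2 a1 a0) U a b z dz w -> U t ->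
  is_derive (K := C_AbsRing) (V := C_NormedModule) (piece_period a b z dz w k) t
    (RtoC (2 / 3 + INR k) * piece_period a b z dz w (S k) t).
Proof.
intros HU P Ht.
assert (HI := is_RInt_Cmult (RtoC (2 / 3 + INR k)) _ _ _ _
  (is_RInt_piece_period _ _ _ _ _ _ _ _ _ _ (S k) t P Ht)).
rewrite <- (is_RInt_unique (V := C_R_CompleteNormedModule) _ _ _ _ HI).
apply is_derive_RInt_strip.
- exact (piece_le _ _ _ _ _ _ _ P).
- generalize (proj1 (locally_C _ _) (HU t Ht)); apply filter_imp; intros u Hu.
  eexists; exact (is_RInt_piece_period _ _ _ _ _ _ _ _ _ _ k u P Hu).
- eexists; exact HI.
- assert (Hz := expands_const (strip a b t) (fun p => fst p - t) (fun p => dz (snd p))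
    (strip_continuous_bounded a b t dz (piece_velocity _ _ _ _ _ _ _ P))).
  refine (expands_ext _ _ _ _ _ _ _ _ _ _ _ (expands_mult _ _ _ _ _ _ _ _
    (strip_increment a b t) (expands_kernel _ _ _ _ _ _ _ _ _ _ k t HU P Ht) Hz));
    intros p; simpl; ring.
Qed.

(* [w Q / u^2] is [Q^(2/3) u^(-8/3)]. *)
Definition primitive (a3 a2 a1 a0 : C) (z w t : C) : C :=
  - (90) * w * quartic a3 a2 a1 a0 z * (/ (z - t)) ^ 2.

Lemma relation_piece_period (a3 a2 a1 a0 : C) (U : C -> Prop) (a b : R) (z dz : R -> C)
  (w : C -> R -> C) (t : C) :
  branch_piece (quartic a3 a2 a1 a0) U a b z dz w -> U t ->
  240 * quartic a3 a2 a1 a0 t * piece_period a b z dz w 3 t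
  + 180 * quartic1 a3 a2 a1 t * piece_period a b z dz w 2 t
  + 60 * quartic2 a3 a2 t * piece_period a b z dz w 1 t
  + 10 * quartic3 a3 t * piece_period a b z dz w 0 t
  = primitive a3 a2 a1 a0 (z b) (w t b) t - primitive a3 a2 a1 a0 (z a) (w t a) t.
Proof.
intros P Ht.
assert (HI := fun c k => is_RInt_Cmult c _ _ _ _
  (is_RInt_piece_period _ _ _ _ _ _ _ _ _ _ k t P Ht)).
set (f := fun s : R => 240 * quartic a3 a2 a1 a0 t * (kernel z w 3 t s * dz s)
  + 180 * quartic1 a3 a2 a1 t * (kernel z w 2 t s * dz s)
  + 60 * quartic2 a3 a2 t * (kernel z w 1 t s * dz s)
  + 10 * quartic3 a3 t * (kernel z w 0 t s * dz s)).
assert (H : is_RInt (V := C_R_NormedModule) f a b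
  (240 * quartic a3 a2 a1 a0 t * piece_period a b z dz w 3 t
   + 180 * quartic1 a3 a2 a1 t * piece_period a b z dz w 2 t
   + 60 * quartic2 a3 a2 t * piece_period a b z dz w 1 t
   + 10 * quartic3 a3 t * piece_period a b z dz w 0 t)).
{ repeat refine (is_RInt_plus (V := C_R_NormedModule) _ _ _ _ _ _ _ _); apply HI. }
apply (is_RInt_unique (V := C_R_CompleteNormedModule)) in H.
etransitivity; [symmetry; exact H|].
assert (Cz := piece_path _ _ _ _ _ _ _ P).
assert (Cw := fun s => piece_continuous _ _ _ _ _ _ _ P t s Ht).
assert (Ci := fun s => continuous_inv_piece _ _ _ _ _ _ _ _ _ _ t s P Ht).
apply (is_RInt_unique (V := C_R_CompleteNormedModule)).
apply (is_RInt_open_derive (fun s => primitive a3 a2 a1 a0 (z s) (w t s) t)).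
- exact (piece_le _ _ _ _ _ _ _ P).
- intros s; unfold primitive; simpl.
  continuity_C; [apply Cw|apply continuous_quartic, Cz|apply Ci..].
- intros s; unfold f.
  assert (Ck := fun k => continuous_kernel _ _ _ _ _ _ _ _ _ _ k t s P Ht).
  assert (Cd := piece_velocity _ _ _ _ _ _ _ P s).
  continuity_C; apply Ck.
- intros s Hs.
  assert (Hd : little_o (locally s) const1 (fun y : R => RtoC (y - s))).
  { intros eps He; exists (mkposreal eps He); intros y Hy; unfold const1.
    rewrite Cmod_1, Cmod_R, Rmult_1_r; left; exact Hy. }
  assert (Hc := fun c : C => expands_const (locally s) (fun y : R => RtoC (y - s))
    (fun _ => c) (big_O_const (locally s) c)).
  assert (Hz := expands_of_is_derive _ _ _ (piece_derive _ _ _ _ _ _ _ P s Hs)).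
  assert (Hq := expands_quartic _ a3 a2 a1 a0 _ _ _ _ Hd Hz).
  assert (Hu := expands_plus _ _ _ _ _ _ _ _ Hz (Hc (- t))).
  assert (B := piece_branch _ _ _ _ _ _ _ P t).
  destruct (expands_branch _ _ (w t) (fun _ => w t s) _ _ _ _ _ _ Hd Hu Hq) as [Hw Hi].
  + apply big_O_const, locally_filter.
  + intros eps He.
    assert (HL : locally (T := C_UniformSpace) (w t s)
      (fun x => (Cmod (x - w t s) < eps)%R)).
    { apply locally_C, locally_Cmod; exists eps; split; [exact He|easy]. }
    generalize (Cw s _ HL); unfold filtermap; apply filter_imp; intros y Hy.
    unfold const1; rewrite Cmod_1; lra.
  + apply filter_forall; intros y; exact (B y Ht).
  + intros _; exact (B s Ht).
  + apply is_derive_of_expands_R.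
    refine (expands_ext _ _ _ _ _ _ _ _ _ _ _ (expands_mult _ _ _ _ _ _ _ _ Hd
      (expands_mult _ _ _ _ _ _ _ _ Hd (expands_mult _ _ _ _ _ _ _ _ Hd (Hc (- (90)))
      Hw) Hq) (expands_mult _ _ _ _ _ _ _ _ Hd Hi Hi)));
      intros y; unfold primitive, Cminus; simpl; [ring..|].
    assert (Nu : z s + - t <> 0).
    { intros E; apply C1_nz; rewrite <- (B s Ht); unfold Cminus; rewrite E; ring. }
    assert (Nq : quartic a3 a2 a1 a0 (z s) <> 0).
    { intros E; apply C1_nz; rewrite <- (B s Ht), E; ring. }
    (* The middle expression is the derivative of [primitive] after simplification. Its equality
       with [f] is Taylor's formula: multiplied by u^3, the two sides are polynomials in [z] and
       [t]. *)
    transitivity (w t s * dz s * (240 * quartic a3 a2 a1 a0 (z s) * (/ (z s - t)) ^ 3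
      - 60 * quartic1 a3 a2 a1 (z s) * (/ (z s - t)) ^ 2)).
    * unfold Cminus; simpl; field; split; assumption.
    * unfold f, kernel, Cminus; simpl.
      unfold quartic, quartic1, quartic2, quartic3; field; assumption.
Qed.

(** * Assembling the pieces of a loop *)

Definition clamp (a b s : R) : R := Rmax a (Rmin b s).

Lemma clamp_bounds (a b s : R) : (a <= b)%R -> (a <= clamp a b s <= b)%R.
Proof.
intros Hab; unfold clamp; split; [apply Rmax_l|].
apply Rmax_lub; [exact Hab|apply Rmin_l].
Qed.

Lemma clamp_id (a b s : R) : (a <= s <= b)%R -> clamp a b s = s.
Proof.
intros Hs; unfold clamp; rewrite Rmin_right, Rmax_right; lra.
Qed.

Lemma clamp_continuous (a b s : R) : continuous (clamp a b) s.
Proof.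
intros P [e HP]; exists e; intros y Hy; apply HP.
change (Rabs (y - s) < e)%R in Hy; change (Rabs (clamp a b y - clamp a b s) < e)%R.
apply Rle_lt_trans with (2 := Hy).
unfold clamp, Rmax, Rmin; repeat destruct Rle_dec; unfold Rabs; repeat destruct Rcase_abs; lra.
Qed.

Lemma locally_open_interval (a b x : R) :
  (a < x < b)%R -> locally x (fun y => (a < y < b)%R).
Proof.
intros Hx.
exact (filter_and _ _ (open_gt a x (proj1 Hx)) (open_lt b x (proj2 Hx))).
Qed.

(** Freezing the parameter outside [a, b] extends the branch relation and continuity to all real
    [s], while inside the piece nothing changes. Uniformity comes from the joint continuity on U x
    [0, 1]. *)
Lemma branch_piece_of_loop (Q : C -> C) (U : C -> Prop) (l : const_loop Q U)
  (a b : R) (h dh : R -> C) :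
  open (T := C_UniformSpace) U -> (0 <= a)%R -> (a <= b)%R -> (b <= 1)%R ->
  (forall x, is_derive (K := R_AbsRing) (V := C_R_NormedModule) h x (dh x) /\
     continuous (U := C_UniformSpace) dh x) ->
  (forall x, (a <= x <= b)%R -> loop_path l x = h x) ->
  branch_piece Q U a b (fun s => h (clamp a b s)) (fun s => dh (clamp a b s))
    (fun t s => loop_branch l t (clamp a b s)).
Proof.
intros HU Ha Hab Hb Hh Hg.
assert (H01 : forall s, (a <= s <= b)%R -> (0 <= s <= 1)%R) by (intros; lra).
assert (Hc := fun s => clamp_bounds a b s Hab).
assert (Ch : forall s, continuous (U := C_UniformSpace) h s).
{ intros s; apply (ex_derive_continuous (V := C_R_NormedModule)).
  eexists; apply Hh. }
split.
- exact Hab.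
- intros s; apply continuous_comp; [apply clamp_continuous|apply Ch].
- intros s; apply continuous_comp; [apply clamp_continuous|apply Hh].
- intros s Hs; rewrite (clamp_id a b s) by lra.
  apply (is_derive_ext_loc (K := R_AbsRing) (V := C_R_NormedModule) h); [|apply Hh].
  generalize (locally_open_interval a b s Hs); apply filter_imp; intros y Hy.
  rewrite clamp_id; [reflexivity|lra].
- intros t s Ht; rewrite <- Hg by apply Hc.
  assert (W := loop_branchP _ _ l t _ Ht (H01 _ (Hc s))).
  assert (N1 := loop_avoids_t _ _ l t _ Ht (H01 _ (Hc s))).
  assert (N2 := loop_avoids_zeros _ _ l _ (H01 _ (Hc s))).
  unfold is_branch_value in W; fold (loop_path l) in N1, N2.
  assert (N3 : loop_path l (clamp a b s) - t <> 0).
  { intros E; apply N1; rewrite <- (Cplus_0_r t), <- E; ring. }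
  etransitivity; [apply f_equal2; [exact W|reflexivity]|].
  field; split; assumption.
- intros t s Ht P HP.
  assert (L := loop_branch_continuous _ _ l t _ Ht (H01 _ (Hc s)) P HP).
  destruct L as [e He].
  destruct (clamp_continuous a b s _ (locally_ball _ e)) as [d Hd].
  exists d; intros y Hy.
  (* Joint continuity is restricted to the slice of fixed [t]; [clamp] keeps the second coordinate
     in the domain where it is assumed. *)
  apply (He (t, clamp a b y)).
  + split; [apply ball_center|exact (Hd y Hy)].
  + split; [exact Ht|exact (H01 _ (Hc y))].
- intros t Ht.
  apply little_o_ext_loc with (fun p => loop_branch l (fst p) (snd p) - loop_branch l t (snd p)).
  + apply strip_filter.
  + exists 1%R; split; [lra|]; intros u s _ Hs; simpl; rewrite clamp_id by exact Hs; reflexivity.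
  + apply (strip_joint_continuous (fun p : C * R => U (fst p) /\ (0 <= snd p <= 1)%R)).
    * intros s Hs; split; [exact Ht|exact (H01 s Hs)].
    * intros s Hs; exact (loop_branch_continuous _ _ l t s Ht (H01 s Hs)).
    * apply filter_and; [apply strip_param, locally_C, HU, Ht|].
      apply (strip_path a b t (fun s => (0 <= s <= 1)%R)), H01.
Qed.

(* [J k] plays the role of the integral of [w (z - t)^(-k) dz] and [B] that of the
   boundary values of a primitive. *)
Definition period_system (a3 a2 a1 a0 : C) (U : C -> Prop) (J : nat -> C -> C)
    (B : C -> C) : Prop :=
  forall t : C, U t ->
    (forall k, is_derive (K := C_AbsRing) (V := C_NormedModule) (J k) t
       (RtoC (2 / 3 + INR k) * J (S k) t)) /\
    240 * quartic a3 a2 a1 a0 t * J 3%nat t + 180 * quartic1 a3 a2 a1 t * J 2%nat t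
    + 60 * quartic2 a3 a2 t * J 1%nat t + 10 * quartic3 a3 t * J 0%nat t = B t.

Lemma period_system_0 (a3 a2 a1 a0 : C) (U : C -> Prop) :
  period_system a3 a2 a1 a0 U (fun _ _ => 0) (fun _ => 0).
Proof.
intros t _; split; [intros k|ring].
rewrite Cmult_0_r; exact (is_derive_const (V := C_NormedModule) (RtoC 0) t).
Qed.

Lemma period_system_plus (a3 a2 a1 a0 : C) (U : C -> Prop)
  (J K : nat -> C -> C) (B D : C -> C) :
  period_system a3 a2 a1 a0 U J B -> period_system a3 a2 a1 a0 U K D ->
  period_system a3 a2 a1 a0 U (fun k t => J k t + K k t) (fun t => B t + D t).
Proof.
intros HJ HK t Ht; destruct (HJ t Ht) as [DJ RJ]; destruct (HK t Ht) as [DK RK].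
split; [intros k|rewrite <- RJ, <- RK; ring].
rewrite Cmult_plus_distr_l; exact (is_derive_plus _ _ _ _ _ (DJ k) (DK k)).
Qed.

Lemma is_derive_Cmult (c : C) (f : C -> C) (t l : C) :
  is_derive (K := C_AbsRing) (V := C_NormedModule) f t l ->
  is_derive (K := C_AbsRing) (V := C_NormedModule) (fun u => c * f u) t (c * l).
Proof.
intros H.
refine (filterdiff_ext_lin _ _ _ (filterdiff_scal_r_fct
  (U := AbsRing_NormedModule C_AbsRing) (V := C_NormedModule) c f _ Cmult_comm H) _).
intros y.
unfold scal; simpl; unfold mult; simpl; ring.
Qed.

Lemma period_system_Cmult (a3 a2 a1 a0 : C) (U : C -> Prop) (c : C)
  (J : nat -> C -> C) (B : C -> C) :
  period_system a3 a2 a1 a0 U J B ->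
  period_system a3 a2 a1 a0 U (fun k t => c * J k t) (fun t => c * B t).
Proof.
intros HJ t Ht; destruct (HJ t Ht) as [DJ RJ].
split; [intros k|rewrite <- RJ; ring].
replace (RtoC (2 / 3 + INR k) * (c * J (S k) t)) with
  (c * (RtoC (2 / 3 + INR k) * J (S k) t)) by ring.
exact (is_derive_Cmult _ _ _ _ (DJ k)).
Qed.

Lemma loop_piece_system (a3 a2 a1 a0 : C) (U : C -> Prop)
  (l : const_loop (quartic a3 a2 a1 a0) U) (a b : R) (h dh : R -> C) :
  open (T := C_UniformSpace) U -> (0 <= a)%R -> (a <= b)%R -> (b <= 1)%R ->
  (forall x, is_derive (K := R_AbsRing) (V := C_R_NormedModule) h x (dh x) /\
     continuous (U := C_UniformSpace) dh x) ->
  (forall x, (a <= x <= b)%R -> loop_path l x = h x) ->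
  exists J : nat -> C -> C,
    period_system a3 a2 a1 a0 U J (fun t =>
      primitive a3 a2 a1 a0 (loop_path l b) (loop_branch l t b) t
      - primitive a3 a2 a1 a0 (loop_path l a) (loop_branch l t a) t) /\
    forall t, U t -> is_RInt (V := C_R_NormedModule)
      (fun s => loop_branch l t s * path_derive (loop_path l) s) a b (J 0%nat t).
Proof.
intros HU Ha Hab Hb Hh Hg.
assert (P := branch_piece_of_loop _ _ l a b h dh HU Ha Hab Hb Hh Hg).
eexists; split.
- intros t Ht; split.
  + intros k; exact (is_derive_piece_period _ _ _ _ _ _ _ _ _ _ k t HU P Ht).
  + etransitivity; [exact (relation_piece_period _ _ _ _ _ _ _ _ _ _ t P Ht)|].
    simpl; rewrite !clamp_id, !Hg by lra; reflexivity.
- intros t Ht.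
  refine (is_RInt_ext _ _ _ _ _ _ (is_RInt_piece_period _ _ _ _ _ _ _ _ _ _ 0%nat t P Ht)).
  (* The integrands need to agree only for [a < s < b]; at the ends the path may have a corner,
     where [path_derive] is meaningless. *)
  rewrite Rmin_left, Rmax_right by exact Hab; intros s Hs.
  unfold kernel; rewrite clamp_id by lra; simpl.
  rewrite Cmult_1_r; apply f_equal.
  assert (D : is_derive (K := R_AbsRing) (V := C_R_NormedModule) (loop_path l) s (dh s)).
  { apply (is_derive_ext_loc (K := R_AbsRing) (V := C_R_NormedModule) h); [|apply Hh].
    generalize (locally_open_interval a b s Hs); apply filter_imp; intros y Hy.
    symmetry; apply Hg; lra. }
  apply injective_projections; symmetry; apply is_derive_unique;
    [exact (is_derive_fst _ _ _ D)|exact (is_derive_snd _ _ _ D)].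
Qed.

(** Path and branch have a single value at each corner, so the boundary terms of adjacent pieces
    cancel; closedness cancels the two that remain. *)
Lemma loop_period_system (a3 a2 a1 a0 : C) (U : C -> Prop)
  (l : const_loop (quartic a3 a2 a1 a0) U) :
  open (T := C_UniformSpace) U ->
  exists J : nat -> C -> C, period_system a3 a2 a1 a0 U J (fun _ => 0) /\
    forall t, U t -> loop_period l t = J 0%nat t.
Proof.
intros HU.
destruct (loop_path_C1 _ _ l) as [n [s [S0 [Sn Hs]]]]; fold (loop_path l) in Hs.
assert (Mono : forall i j, (i <= j)%nat -> (j <= n)%nat -> (s i <= s j)%R).
{ intros i j Hij; induction Hij as [|j Hij IH]; intros Hj; [lra|].
  apply Rle_trans with (s j); [apply IH; lia|left; apply Hs; lia]. }
assert (Partial : forall m, (m <= n)%nat -> exists J : nat -> C -> C,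
  period_system a3 a2 a1 a0 U J (fun t =>
    primitive a3 a2 a1 a0 (loop_path l (s m)) (loop_branch l t (s m)) t
    - primitive a3 a2 a1 a0 (loop_path l 0) (loop_branch l t 0) t) /\
  forall t, U t -> is_RInt (V := C_R_NormedModule)
    (fun x => loop_branch l t x * path_derive (loop_path l) x) 0 (s m) (J 0%nat t)).
{ induction m as [|m IH]; intros Hm.
  - exists (fun _ _ => 0); rewrite S0; split.
    + intros t Ht; destruct (period_system_0 a3 a2 a1 a0 U t Ht) as [D E].
      split; [exact D|rewrite E; ring].
    + intros t _; exact (is_RInt_point (V := C_R_NormedModule) _ 0%R).
  - destruct (IH ltac:(lia)) as [J [HJ IJ]].
    destruct (Hs m Hm) as [Lt [h [dh [Hh Hg]]]].
    destruct (loop_piece_system a3 a2 a1 a0 U l (s m) (s (S m)) h dh HU) as [K [HK IK]].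
    + rewrite <- S0; apply Mono; lia.
    + lra.
    + rewrite <- Sn; apply Mono; lia.
    + exact Hh.
    + exact Hg.
    + exists (fun k t => J k t + K k t); split.
      * intros t Ht; destruct (period_system_plus _ _ _ _ _ _ _ _ _ HJ HK t Ht) as [D E].
        split; [exact D|rewrite E; ring].
      * intros t Ht.
        exact (is_RInt_Chasles (V := C_R_NormedModule) _ _ _ _ _ _ (IJ t Ht) (IK t Ht)). }
destruct (Partial n (le_n n)) as [J [HJ IJ]]; rewrite Sn in HJ, IJ.
exists J; split.
- intros t Ht; destruct (HJ t Ht) as [D E]; split; [exact D|].
  (* Equal end points of the path alone would leave a cube root of unity between the two boundary
     values; closedness of the branch excludes it. *)
  rewrite E, (loop_path_closed _ _ l : loop_path l 0 = loop_path l 1),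
    (loop_branch_closed _ _ l t Ht : loop_branch l t 0 = loop_branch l t 1); ring.
- intros t Ht.
  exact (is_RInt_unique (V := C_R_CompleteNormedModule) _ _ _ _ (IJ t Ht)).
Qed.

Lemma cycle_period_system (a3 a2 a1 a0 : C) (U : C -> Prop)
  (gamma : locally_constant_cycle (quartic a3 a2 a1 a0) U) :
  open (T := C_UniformSpace) U ->
  exists J : nat -> C -> C, period_system a3 a2 a1 a0 U J (fun _ => 0) /\
    forall t, U t -> period gamma t = J 0%nat t.
Proof.
intros HU; induction gamma as [|[m l] gamma [J [HJ EJ]]].
- exists (fun _ _ => 0); split; [apply period_system_0|reflexivity].
- destruct (loop_period_system a3 a2 a1 a0 U l HU) as [K [HK EK]].
  exists (fun k t => RtoC (IZR m) * K k t + J k t); split.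
  + intros t Ht.
    destruct (period_system_plus _ _ _ _ _ _ _ _ _
      (period_system_Cmult _ _ _ _ _ (RtoC (IZR m)) _ _ HK) HJ t Ht) as [D E].
    split; [exact D|rewrite E; ring].
  + intros t Ht; simpl; rewrite (EK t Ht), <- (EJ t Ht); reflexivity.
Qed.

(** * Iterated derivatives *)

(** The Pochhammer symbol of 2/3: the coefficients picked up by [k] successive differentiations of
    [J 0]. *)
Fixpoint rising (k : nat) : R :=
  match k with O => 1 | S j => rising j * (2 / 3 + INR j) end.

(** A derivative at [t] depends on values near [t], so the formula at order [k] must hold on all of
    [U] before the next derivative is taken; openness of [U] makes this agreement local. Values and
    derivatives are thus obtained alternately. *)
Lemma iterated_derive (U : C -> Prop) (I : C -> C) (J : nat -> C -> C) :
  open (T := C_UniformSpace) U -> (forall t, U t -> I t = J 0%nat t) ->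
  (forall t k, U t -> is_derive (K := C_AbsRing) (V := C_NormedModule) (J k) t
     (RtoC (2 / 3 + INR k) * J (S k) t)) ->
  forall k t, U t -> C_derive_n k I t = RtoC (rising k) * J k t /\
    is_derive (K := C_AbsRing) (V := C_NormedModule) (C_derive_n k I) t
      (RtoC (rising (S k)) * J (S k) t).
Proof.
intros HU EI DJ.
assert (Step : forall k, (forall t, U t -> C_derive_n k I t = RtoC (rising k) * J k t) ->
  forall t, U t -> is_derive (K := C_AbsRing) (V := C_NormedModule) (C_derive_n k I) t
      (RtoC (rising (S k)) * J (S k) t)).
{ intros k E t Ht.
  apply (is_derive_ext_loc (K := C_AbsRing) (V := C_NormedModule)
    (fun u => RtoC (rising k) * J k u)).
  - generalize (proj1 (locally_C _ _) (HU t Ht)); apply filter_imp.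
    intros u Hu; symmetry; exact (E u Hu).
  - replace (RtoC (rising (S k)) * J (S k) t) with
      (RtoC (rising k) * (RtoC (2 / 3 + INR k) * J (S k) t))
      by (simpl rising; rewrite RtoC_mult; ring).
    exact (is_derive_Cmult _ _ _ _ (DJ t k Ht)). }
assert (Val : forall k t, U t -> C_derive_n k I t = RtoC (rising k) * J k t).
{ induction k as [|k IH]; intros t Ht.
  - simpl; rewrite (EI t Ht); ring.
  - exact (is_C_derive_unique _ _ _ (Step k IH t Ht)). }
intros k t Ht; split; [exact (Val k t Ht)|exact (Step k (Val k) t Ht)].
Qed.

Lemma C_derive_n_quartic (a3 a2 a1 a0 t : C) :
  C_derive_n 1 (quartic a3 a2 a1 a0) t = quartic1 a3 a2 a1 t /\
  C_derive_n 2 (quartic a3 a2 a1 a0) t = quartic2 a3 a2 t /\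
  C_derive_n 3 (quartic a3 a2 a1 a0) t = quartic3 a3 t.
Proof.
assert (Hd : forall x : C, little_o (locally (T := AbsRing_UniformSpace C_AbsRing) x) const1
  (fun y : C => y - x)).
{ intros x eps He; apply locally_Cmod; exists eps; split; [exact He|].
  intros u Hu; unfold const1; rewrite Cmod_1; lra. }
assert (Hc := fun (x c : C) =>
  expands_const (locally (T := AbsRing_UniformSpace C_AbsRing) x) (fun y : C => y - x)
    (fun _ : C => c) (big_O_const (locally (T := AbsRing_UniformSpace C_AbsRing) x) c)).
assert (Hx : forall x : C, expands (locally (T := AbsRing_UniformSpace C_AbsRing) x)
  (fun y : C => y - x) (fun y : C => y) (fun _ => x) (fun _ => 1)).
{ intros x.
  refine (expands_ext _ _ _ _ _ _ _ _ _ _ _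
    (expands_plus _ _ _ _ _ _ _ _ (Hc x x) (expands_increment _ _)));
    intros y; ring. }
assert (D1 : forall x, C_derive (quartic a3 a2 a1 a0) x = quartic1 a3 a2 a1 x).
{ intros x; apply is_C_derive_unique, is_derive_of_expands.
  refine (expands_ext _ _ _ _ _ _ _ _ _ _ _
    (expands_quartic _ a3 a2 a1 a0 _ _ _ _ (Hd x) (Hx x))); intros y; ring. }
assert (D2 : forall x, C_derive (quartic1 a3 a2 a1) x = quartic2 a3 a2 x).
{ intros x; apply is_C_derive_unique, is_derive_of_expands.
  refine (expands_ext _ _ _ _ _ _ _ _ _ _ _
    (expands_plus _ _ _ _ _ _ _ _ (expands_mult _ _ _ _ _ _ _ _ (Hd x)
    (expands_plus _ _ _ _ _ _ _ _ (expands_mult _ _ _ _ _ _ _ _ (Hd x)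
    (expands_plus _ _ _ _ _ _ _ _ (expands_mult _ _ _ _ _ _ _ _ (Hd x)
    (Hc x 4) (Hx x)) (Hc x (3 * a3))) (Hx x)) (Hc x (2 * a2))) (Hx x)) (Hc x a1)));
    intros y; unfold quartic1, quartic2; simpl; ring. }
assert (D3 : forall x, C_derive (quartic2 a3 a2) x = quartic3 a3 x).
{ intros x; apply is_C_derive_unique, is_derive_of_expands.
  refine (expands_ext _ _ _ _ _ _ _ _ _ _ _
    (expands_plus _ _ _ _ _ _ _ _ (expands_mult _ _ _ _ _ _ _ _ (Hd x)
    (expands_plus _ _ _ _ _ _ _ _ (expands_mult _ _ _ _ _ _ _ _ (Hd x)
    (Hc x 12) (Hx x)) (Hc x (6 * a3))) (Hx x)) (Hc x (2 * a2))));
    intros y; unfold quartic2, quartic3; simpl; ring. }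
unfold C_derive_n; simpl.
(* [C_derive] acts on functions, so the lower derivatives have to be replaced as functions rather
   than at the point [t]. *)
rewrite (functional_extensionality _ _ D1), (functional_extensionality _ _ D2).
repeat split; apply D3.
Qed.

Theorem corollary2 (a3 a2 a1 a0 : C) (U : C -> Prop)
  (U_open : open (T := C_UniformSpace) U)
  (Q_neq0 : forall t : C, U t -> quartic a3 a2 a1 a0 t <> 0)
  (gamma : locally_constant_cycle (quartic a3 a2 a1 a0) U) :
  let Q := quartic a3 a2 a1 a0 in
  let I := period gamma in
  forall t : C, U t ->
    C_ex_derive_n 3 I t /\
    81 * Q t * C_derive_n 3 I t
    + 162 * C_derive_n 1 Q t * C_derive_n 2 I t
    + 90 * C_derive_n 2 Q t * C_derive_n 1 I t
    + 10 * C_derive_n 3 Q t * I t = 0.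
Proof.
intros Q I t Ht.
destruct (cycle_period_system a3 a2 a1 a0 U gamma U_open) as [J [HJ EJ]].
assert (H := iterated_derive U I J U_open EJ (fun u k Hu => proj1 (HJ u Hu) k)).
split.
- intros k _; eexists; exact (proj2 (H k t Ht)).
- destruct (HJ t Ht) as [_ R].
  destruct (C_derive_n_quartic a3 a2 a1 a0 t) as [D1 [D2 D3]].
  unfold Q; rewrite D1, D2, D3.
  rewrite (proj1 (H 3%nat t Ht)), (proj1 (H 2%nat t Ht)), (proj1 (H 1%nat t Ht)).
  fold I in EJ; rewrite (EJ t Ht), <- R.
  (* The coefficients now match those of the period system: 81 * 80/27 = 240, 162 * 10/9 = 180 and
     90 * 2/3 = 60. *)
  replace (rising 3) with (80 / 27)%R by (simpl; field).
  replace (rising 2) with (10 / 9)%R by (simpl; field).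
  replace (rising 1) with (2 / 3)%R by (simpl; field).
  rewrite !RtoC_div by lra; field.
Qed.
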